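(* Let $A,B\in\mathbb M(n)$, $1\le k\le n$, and let $A=U|A|$ be a polar decomposition of $A$. If there exist $k$ orthonormal vectors $u_1,\dots,u_k\in\mathbb C^n$ such that $|A|u_i=s_i(A)u_i$ for all $1\le i\le k$ and $\sum_{i=1}^k\operatorname{Re}\langle u_i,U^*Bu_i\rangle=0$, then $\|A+tB\|_{(k)}\ge\|A\|_{(k)}$ for all $t\in\mathbb R$. If $s_k(A)>0$, then the converse also holds.
   Context: $U$ is unitary and $|A|=(A^*A)^{1/2}$. $s_1(A)\ge\dots\ge s_n(A)$ are the singular values of $A$ and $\|A\|_{(k)}=\sum_{i=1}^ks_i(A)$ is the Ky Fan $k$-norm. Inner products are conjugate linear in the first argument and linear in the second. *)

(* Defs.v *)
From HB Require Import structures.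
From mathcomp Require Import all_boot all_order all_algebra.
Set Implicit Arguments. Unset Strict Implicit. Unset Printing Implicit Defensive.
Import Order.TTheory GRing.Theory Num.Theory Num.Def.
Local Open Scope ring_scope.

Definition adjmx (C : numClosedFieldType) m n (A : 'M[C]_(m, n)) : 'M[C]_(n, m) :=
  (map_mx conjC A)^T.

(* <x, y> = x^* y : conjugate linear in the first argument *)
Definition inner (C : numClosedFieldType) n (x y : 'cV[C]_n) : C :=
  (adjmx x *m y) 0 0.

(* |A| = (A^* A)^{1/2}: the positive square root of the psd matrix A^*A, built
   from its (unitary) spectral decomposition A^*A = P^-1 diag(d) P. *)
Definition absmx (C : numClosedFieldType) n (A : 'M[C]_n) : 'M[C]_n :=
  let H := adjmx A *m A in
  invmx (spectralmx H) *m diag_mx (map_mx sqrtC (spectral_diag H)) *m spectralmx H.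

Definition sing_vals (C : numClosedFieldType) n (A : 'M[C]_n) : seq C :=
  sort (fun x y : C => y <= x)
    [seq sqrtC (spectral_diag (adjmx A *m A) 0 i) | i <- enum 'I_n].

(* s_i(A), 1-based: s_i(A) = nth 0 (sing_vals A) (i-1) *)
Definition sv (C : numClosedFieldType) n (A : 'M[C]_n) (i : nat) : C :=
  nth 0 (sing_vals A) i.-1.

Definition kyfan (C : numClosedFieldType) n (k : nat) (A : 'M[C]_n) : C :=
  \sum_(1 <= i < k.+1) sv A i.

(* Main.v *)
(** The norm bound rests on the variational inequality
    Re tr (Q^* X P) <= ||X||_(k) for n x k contractions P and Q, which is attained.
    Taking for P the columns u_i and Q = U P gives the first implication.

    For the converse, choose an orthonormal basis e_1, ..., e_n of eigenvectors
    of |A|, with decreasing eigenvalues d_j, in which the hermitian part M of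
    U^*B is diagonal inside each eigenspace of |A|. Let s = s_k(A), and let S
    be a set of k indices containing all j with d_j > s and none with d_j < s.
    If S selects the largest diagonal entries of M inside the eigenspace of s
    and if sum_S M_jj < 0, then ||A + tB||_(k) < ||A||_(k) for a small t > 0.
    No compactness is available over an arbitrary closed field, so this is made
    quantitative: for contractions u, v put p = (u+v)/2 and P = p p^*; a
    defect omega >= 0 of P from a projection selecting S costs at least g omega
    in the main term, with a fixed spectral gap g > 0, and gains at most
    t (theta + c_theta omega) in the first-order term, for any theta > 0. Applied to B and to -B, this shows that the sum over the top choice
    of S is >= 0 and that over the bottom choice is <= 0. Rotating the first
    choice into the second by vectors x e_j + y e_(g j) with x^2 + y^2 = 1 makes
    the sum vanish for a suitable x. *)
Require Import Defs.
From HB Require Import structures.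
From mathcomp Require Import all_boot all_order all_algebra.
From mathcomp Require Import ring zify.
Set Implicit Arguments. Unset Strict Implicit. Unset Printing Implicit Defensive.
Import Order.TTheory GRing.Theory Num.Theory Num.Def.
Local Open Scope ring_scope.
Local Notation "A ^H" := (adjmx A) (at level 8, format "A ^H").

(** * Adjoints and contractions *)

Section Adjoint.
Variable C : numClosedFieldType.

Lemma adjmxE m n (A : 'M[C]_(m, n)) i j : A^H i j = (A j i)^*.
Proof. by rewrite !mxE. Qed.

Lemma adjmxK m n (A : 'M[C]_(m, n)) : A^H^H = A.
Proof. by apply/matrixP=> i j; rewrite !adjmxE conjCK. Qed.

Lemma adjmxM m n p (A : 'M[C]_(m, n)) (B : 'M[C]_(n, p)) :
  (A *m B)^H = B^H *m A^H.
Proof. by rewrite /adjmx map_mxM trmx_mul. Qed.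

Lemma adjmxD m n (A B : 'M[C]_(m, n)) : (A + B)^H = A^H + B^H.
Proof. by apply/matrixP=> i j; rewrite !(mxE, adjmxE) rmorphD. Qed.

Lemma adjmxB m n (A B : 'M[C]_(m, n)) : (A - B)^H = A^H - B^H.
Proof. by apply/matrixP=> i j; rewrite !(mxE, adjmxE) rmorphB. Qed.

Lemma adjmxZ m n (a : C) (A : 'M[C]_(m, n)) : (a *: A)^H = a^* *: A^H.
Proof. by apply/matrixP=> i j; rewrite !(mxE, adjmxE) rmorphM. Qed.

Lemma adjmx_diag n (d : 'rV[C]_n) : (diag_mx d)^H = diag_mx (map_mx conjC d).
Proof. by rewrite /adjmx map_diag_mx tr_diag_mx. Qed.

Lemma adjmx_diag_real n (d : 'rV[C]_n) :
  (forall i, d 0 i \is Num.real) -> (diag_mx d)^H = diag_mx d.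
Proof.
move=> dr; rewrite adjmx_diag; congr diag_mx.
by apply/rowP=> i; rewrite mxE conj_Creal.
Qed.

Lemma mxtrace_adj n (A : 'M[C]_n) : \tr A^H = (\tr A)^*.
Proof. by rewrite /mxtrace rmorph_sum; apply: eq_bigr => i _; rewrite adjmxE. Qed.

Lemma adjmx_trC m n (A : 'M[C]_(m, n)) : A^H = map_mx conjC A^T.
Proof. by rewrite /adjmx map_trmx. Qed.

Lemma unitary_mulmxV n (U : 'M[C]_n) : U \is unitarymx -> U *m U^H = 1%:M.
Proof. by move/unitarymxP; rewrite adjmx_trC. Qed.

Lemma unitary_mulVmx n (U : 'M[C]_n) : U \is unitarymx -> U^H *m U = 1%:M.
Proof. by move/unitary_mulmxV/mulmx1C. Qed.

Lemma mulVmx_unitary n (U : 'M[C]_n) : U^H *m U = 1%:M -> U \is unitarymx.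
Proof. by move/mulmx1C=> h; apply/unitarymxP; rewrite -adjmx_trC. Qed.

Lemma adjmx_unitary n (U : 'M[C]_n) : U \is unitarymx -> U^H \is unitarymx.
Proof. by move=> hU; apply: mulVmx_unitary; rewrite adjmxK unitary_mulmxV. Qed.

Lemma innerDl n (x y z : 'cV[C]_n) : inner (x + y) z = inner x z + inner y z.
Proof. by rewrite /inner adjmxD mulmxDl mxE. Qed.

Lemma innerDr n (x y z : 'cV[C]_n) : inner z (x + y) = inner z x + inner z y.
Proof. by rewrite /inner mulmxDr mxE. Qed.

Lemma innerBl n (x y z : 'cV[C]_n) : inner (x - y) z = inner x z - inner y z.
Proof. by rewrite /inner adjmxB mulmxBl !mxE. Qed.

Lemma innerBr n (x y z : 'cV[C]_n) : inner z (x - y) = inner z x - inner z y.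
Proof. by rewrite /inner mulmxBr !mxE. Qed.

Lemma innerZl n a (x y : 'cV[C]_n) : inner (a *: x) y = a^* * inner x y.
Proof. by rewrite /inner adjmxZ -scalemxAl !mxE. Qed.

Lemma innerZr n a (x y : 'cV[C]_n) : inner x (a *: y) = a * inner x y.
Proof. by rewrite /inner -scalemxAr !mxE. Qed.

Lemma inner_adj m n (A : 'M[C]_(m, n)) x y :
  inner x (A *m y) = inner (A^H *m x) y.
Proof. by rewrite /inner adjmxM adjmxK mulmxA. Qed.

Lemma inner_conj n (x y : 'cV[C]_n) : inner y x = (inner x y)^*.
Proof. by rewrite /inner -adjmxE adjmxM adjmxK. Qed.

Lemma inner_normE n (x : 'cV[C]_n) : inner x x = \sum_i `|x i 0| ^+ 2.
Proof.
by rewrite /inner mxE; apply: eq_bigr => i _; rewrite adjmxE mulrC normCK.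
Qed.

Lemma inner_ge0 n (x : 'cV[C]_n) : 0 <= inner x x.
Proof. by rewrite inner_normE sumr_ge0 // => i _; rewrite exprn_ge0. Qed.

Lemma inner_col m n p (A : 'M[C]_(m, n)) (B : 'M[C]_(m, p)) i j :
  inner (col i A) (col j B) = (A^H *m B) i j.
Proof.
by rewrite /inner !mxE; apply: eq_bigr => l _; rewrite !adjmxE !mxE.
Qed.

Definition contraction m n (A : 'M[C]_(m, n)) : Prop :=
  forall x, inner (A *m x) (A *m x) <= inner x x.

(** With y = A^H x, expand 0 <= |x - A y|^2 and use |A y| <= |y|; what remains is |y|^2 <= |x|^2. *)
Lemma contraction_adj m n (A : 'M[C]_(m, n)) : contraction A -> contraction A^H.
Proof.
move=> cA x; set y := A^H *m x.
have := inner_ge0 (x - A *m y); have := cA y.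
rewrite innerBl !innerBr inner_adj -/y (inner_conj x (A *m y)) inner_adj -/y.
rewrite (conj_Creal (ger0_real (inner_ge0 y))) => h1 h2.
rewrite -subr_ge0 (le_trans h2) // -subr_ge0.
move: h1; rewrite -subr_ge0; congr (0 <= _); ring.
Qed.

Lemma contractionM m n p (A : 'M[C]_(m, n)) (B : 'M[C]_(n, p)) :
  contraction A -> contraction B -> contraction (A *m B).
Proof. by move=> cA cB x; rewrite -mulmxA (le_trans (cA _)). Qed.

Lemma isometry_contraction m n (A : 'M[C]_(m, n)) :
  A^H *m A = 1%:M -> contraction A.
Proof. by move=> h x; rewrite inner_adj mulmxA h mul1mx. Qed.

Lemma contraction_unitary n (U : 'M[C]_n) : U \is unitarymx -> contraction U.
Proof. by move/unitary_mulVmx/isometry_contraction. Qed.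

Lemma contraction_col m n (A : 'M[C]_(m, n)) j :
  contraction A -> \sum_i `|A i j| ^+ 2 <= 1.
Proof.
move=> /(_ (delta_mx j 0)); rewrite -colE 2!inner_normE.
under eq_bigr do rewrite mxE.
rewrite [X in _ <= X](bigD1 j) //= !mxE !eqxx normr1 expr1n [X in 1 + X]big1 ?addr0 //.
by move=> i ij; rewrite !mxE (negPf ij) normr0 expr0n.
Qed.

Lemma contraction_row m n (A : 'M[C]_(m, n)) i :
  contraction A -> \sum_j `|A i j| ^+ 2 <= 1.
Proof.
move/contraction_adj/contraction_col => /(_ i).
by under eq_bigr do rewrite adjmxE norm_conjC.
Qed.

(** By the parallelogram law. *)
Lemma contraction_half m n (A B : 'M[C]_(m, n)) :
  contraction A -> contraction B -> contraction (2^-1 *: (A + B)).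
Proof.
move=> cA cB x; have := inner_ge0 ((A *m x) - (B *m x)).
have h2 : (2^-1)^* = 2^-1 :> C.
  by rewrite conj_Creal // rpredV realn.
rewrite -scalemxAl innerZl innerZr h2 mulmxDl.
set a := A *m x; set b := B *m x => h.
rewrite -subr_ge0.
have -> : inner x x - 2^-1 * (2^-1 * inner (a + b) (a + b)) =
  2^-1 * (inner x x - inner a a) + 2^-1 * (inner x x - inner b b)
  + 2^-1 * 2^-1 * inner (a - b) (a - b).
  by rewrite !(innerBl, innerBr, innerDl, innerDr); field.
have i2 : 0 <= 2^-1 :> C by rewrite invr_ge0 ler0n.
rewrite !addr_ge0 ?mulr_ge0 // subr_ge0; [exact: cA|exact: cB].
Qed.

End Adjoint.

(** * Weighted sums compared with sums over a set of top indices *)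

Section Weights.
Variables (C : numClosedFieldType) (n : nat).
Implicit Types (S : {set 'I_n}) (x p : 'I_n -> C).

(** For weights in [0, 1], the distance from [p j] to the indicator of [S]. *)
Definition slack S p j := if j \in S then 1 - p j else p j.

Lemma slack_ge0 S p j : 0 <= p j <= 1 -> 0 <= slack S p j.
Proof. by rewrite /slack => /andP[p0 p1]; case: ifP => _; rewrite ?subr_ge0. Qed.

(** A termwise identity. When [r] separates the values on [S] from those off [S], the signed factor
    is |x j - r|, so the last sum is a loss, kept exact in order to be measured later. *)
Lemma weighted_sumE S x p r :
  \sum_j x j * p j = \sum_(j in S) x j - r * (#|S|%:R - \sum_j p j)
    - \sum_j (-1) ^+ (j \notin S) * (x j - r) * slack S p j.
Proof.
have -> : #|S|%:R = \sum_j (j \in S)%:R :> C.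
  by rewrite -natr_sum -sum1_card big_mkcond.
rewrite -sumrB mulr_sumr [\sum_(j in S) _]big_mkcond -!sumrB; apply: eq_bigr => j _.
rewrite /slack; case: (j \in S) => /=; ring.
Qed.

Lemma weighted_sum_le S x p r : 0 <= r ->
  (forall j, j \in S -> r <= x j) -> (forall j, j \notin S -> x j <= r) ->
  (forall j, 0 <= p j <= 1) -> \sum_j p j <= #|S|%:R ->
  \sum_j x j * p j <= \sum_(j in S) x j.
Proof.
move=> r0 xS xnS p01 psum; rewrite (weighted_sumE S x p r).
rewrite -addrA gerDl -opprD oppr_le0 addr_ge0 ?mulr_ge0 ?subr_ge0 //.
rewrite sumr_ge0 // => j _; rewrite mulr_ge0 ?slack_ge0 //.
case: (boolP (j \in S)) => jS /=; first by rewrite mul1r subr_ge0 xS.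
by rewrite expr1 mulN1r opprB subr_ge0 xnS.
Qed.

End Weights.

(** * Spectra and singular values *)

Section Spectrum.
Variable C : numClosedFieldType.

Lemma char_poly_conj n (E F M : 'M[C]_n) :
  F *m E = 1%:M -> char_poly (E *m M *m F) = char_poly M.
Proof.
move=> FE; have EF := mulmx1C FE; rewrite /char_poly.
suff -> : char_poly_mx (E *m M *m F) =
    map_mx polyC E *m char_poly_mx M *m map_mx polyC F.
  rewrite !det_mulmx mulrC mulrA -det_mulmx -map_mxM FE.
  by rewrite map_mx1 det1 mul1r.
rewrite /char_poly_mx mulmxBr mulmxBl !map_mxM; congr (_ - _).
by rewrite scalar_mxC -mulmxA -map_mxM EF map_mx1 mulmx1.
Qed.

Lemma spectrum_perm n (E E' : 'M[C]_n) (z z' : 'rV[C]_n) :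
  E \is unitarymx -> E' \is unitarymx ->
  E *m diag_mx z *m E^H = E' *m diag_mx z' *m E'^H ->
  perm_eq [seq z 0 i | i <- enum 'I_n] [seq z' 0 i | i <- enum 'I_n].
Proof.
move=> hE hE' /(congr1 char_poly).
rewrite !char_poly_conj ?unitary_mulVmx // !char_poly_trig ?diag_mx_is_trig //.
have diagE (x : 'rV[C]_n) :
    \prod_(i < n) ('X - (diag_mx x i i)%:P) = \prod_(i < n) ('X - (x 0 i)%:P).
  by apply: eq_bigr => i _; rewrite mxE eqxx.
by rewrite !diagE => h; apply: prod_XsubC_eq; rewrite !big_map.
Qed.

(** The order of [C] is only partial; this one is total on it. For commuting hermitian X and Y,
    sorting the eigenvalues of X + iY this way sorts X, and sorts Y inside each eigenspace of X. *)
Definition lexge (z w : C) := ('Re w < 'Re z) || ('Re w == 'Re z) && ('Im w <= 'Im z).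

Lemma lexge_total : total lexge.
Proof.
move=> z w; rewrite /lexge.
case: (real_ltgtP (Creal_Re z) (Creal_Re w)) => //= _.
by case: (real_leP (Creal_Im w) (Creal_Im z)) => //= /ltW.
Qed.

Lemma lexge_trans : transitive lexge.
Proof.
move=> y x z; rewrite /lexge => /orP[xy|/andP[/eqP <- xy]].
  case/orP=> [yz|/andP[/eqP -> _]]; first by rewrite (lt_trans yz xy).
  by rewrite xy.
by case/orP=> [->//|/andP[-> yz]]; rewrite (le_trans yz xy) orbT.
Qed.

Lemma lexge_Re z w : lexge z w -> 'Re w <= 'Re z.
Proof. by case/orP=> [/ltW//|/andP[/eqP->]]. Qed.

Lemma spectral_sorted n (N : 'M[C]_n) : N \is normalmx ->
  exists E : 'M[C]_n, exists z : 'rV[C]_n,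
    [/\ E \is unitarymx, N = E *m diag_mx z *m E^H &
        forall i j : 'I_n, (i <= j)%N -> lexge (z 0 i) (z 0 j)].
Proof.
move=> /orthomx_spectralP; set P := spectralmx N; set sp := spectral_diag N.
have hP : P \is unitarymx := spectral_unitarymx N.
rewrite invmx_unitary // -adjmx_trC => hN.
pose r := relpre (fun i => sp 0 i) lexge.
pose s := sort r (enum 'I_n).
have szs : size s = n by rewrite size_sort size_enum_ord.
have rtr : transitive r by move=> y x z; apply: lexge_trans.
have rrefl : reflexive r.
  by move=> x; have := lexge_total (sp 0 x) (sp 0 x); rewrite orbb.
have srt : sorted r s by apply: sort_sorted => x y; apply: lexge_total.
pose f (i : 'I_n) : 'I_n := nth i s i.
have finj : injective f.
  move=> i j /eqP; rewrite /f (set_nth_default j) ?szs //.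
  by rewrite nth_uniq ?szs ?sort_uniq ?enum_uniq // => /eqP/val_inj.
exists (\matrix_(a, i) P^H a (f i)), (\row_i sp 0 (f i)); split.
- apply: mulVmx_unitary; apply/matrixP=> i j; rewrite !mxE.
  have /matrixP/(_ (f i) (f j)) := unitary_mulmxV hP.
  rewrite !mxE (inj_eq finj) => <-; apply: eq_bigr => a _.
  by rewrite !mxE conjCK.
- rewrite {1}hN; apply/matrixP=> a b; rewrite !mxE (reindex_inj finj).
  apply: eq_bigr => i _; rewrite !mul_mx_diag !mxE conjCK //.
- move=> i j ij; rewrite !mxE /f (set_nth_default i (j : 'I_n)) ?szs //.
  by apply: (sorted_leq_nth rtr rrefl i srt); rewrite ?inE ?szs.
Qed.

Lemma conj_diag_real n (E : 'M[C]_n) (z : 'rV[C]_n) :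
  (forall i, z 0 i \is Num.real) ->
  (E *m diag_mx z *m E^H)^H = E *m diag_mx z *m E^H.
Proof. by move=> zr; rewrite !adjmxM adjmxK adjmx_diag_real // mulmxA. Qed.

Lemma hermitian_normal n (M : 'M[C]_n) : M^H = M -> M \is normalmx.
Proof. by move=> hM; apply/normalmxP; rewrite -adjmx_trC hM. Qed.

Lemma gram_diag_ge0 m n (A : 'M[C]_(m, n)) i : 0 <= (A^H *m A) i i.
Proof. by rewrite -inner_col inner_ge0. Qed.

Lemma absmxE n (A : 'M[C]_n) : exists E : 'M[C]_n, exists h : 'rV[C]_n,
  [/\ E \is unitarymx, forall i, 0 <= h 0 i,
      A^H *m A = E *m diag_mx h *m E^H,
      absmx A = E *m diag_mx (map_mx sqrtC h) *m E^H &
      sing_vals A = sort (fun x y : C => y <= x) [seq sqrtC (h 0 i) | i <- enum 'I_n]].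
Proof.
rewrite /absmx /sing_vals; set H := A^H *m A.
have hH : H^H = H by rewrite adjmxM adjmxK.
have /orthomx_spectralP := hermitian_normal hH.
have hP := spectral_unitarymx H; rewrite !invmx_unitary // -adjmx_trC => e.
exists (spectralmx H)^H, (spectral_diag H); rewrite adjmxK; split=> //.
  exact: adjmx_unitary.
(* Each eigenvalue is a diagonal entry of a Gram matrix, hence a squared norm. *)
move=> i; have := gram_diag_ge0 (A *m (spectralmx H)^H) i.
rewrite adjmxM adjmxK mulmxA -(mulmxA _ A^H) -/H {2}e.
rewrite !mulmxA unitary_mulmxV // mul1mx -mulmxA unitary_mulmxV // mulmx1.
by rewrite mxE eqxx mulr1n.
Qed.

Lemma absmx_sqr n (A : 'M[C]_n) : absmx A *m absmx A = A^H *m A.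
Proof.
have [E [h [hE h0 -> -> _]]] := absmxE A.
rewrite !mulmxA -[_ *m E^H *m E]mulmxA unitary_mulVmx // mulmx1.
rewrite -[E *m _ *m _]mulmxA mulmx_diag; congr (_ *m diag_mx _ *m _).
by apply/rowP=> i; rewrite !mxE -expr2 sqrtCK.
Qed.

(** Since [<=] is not total on [C], sorting is controlled only through the comparability of
    nonnegative entries. *)
Lemma sorted_ge_perm_eq (s t : seq C) :
  {in s, forall x, 0 <= x} -> perm_eq s t ->
  sorted (fun x y : C => y <= x) t -> sort (fun x y : C => y <= x) s = t.
Proof.
move=> s0 st ts.
have tr : transitive (fun x y : C => y <= x) by move=> y x z h1 h2; apply: le_trans h1.
apply: (sorted_eq tr) => //.
- by move=> x y /andP[h1 h2]; apply/eqP; rewrite eq_le h1 h2.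
- apply: (sort_sorted_in (P := [pred x | 0 <= x])).
    by move=> x y /ger0_real xr /ger0_real yr; apply: real_leVge.
  by apply/allP=> x /s0.
- by rewrite perm_sort.
Qed.

(** The spectrum is unique up to permutation, so any decreasing diagonalization of [absmx A] may
    replace the one in its definition. *)
Lemma sing_valsE n (A E : 'M[C]_n) (z : 'rV[C]_n) : E \is unitarymx ->
  absmx A = E *m diag_mx z *m E^H ->
  (forall i j : 'I_n, (i <= j)%N -> z 0 j <= z 0 i) ->
  forall i : 'I_n, sv A i.+1 = z 0 i /\ 0 <= z 0 i.
Proof.
move=> hE hz zs i; have [F [h [hF h0 _ hA hsv]]] := absmxE A.
rewrite hz in hA; have := spectrum_perm hE hF hA.
under [X in perm_eq _ X]eq_map do rewrite mxE.
rewrite perm_sym => pe.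
have ge0 : {in [seq sqrtC (h 0 i) | i <- enum 'I_n], forall x, 0 <= x}.
  by move=> x /mapP[j _ ->]; rewrite sqrtC_ge0.
have -> : sv A i.+1 = z 0 i.
  rewrite /sv hsv /= (sorted_ge_perm_eq ge0 pe).
    by rewrite (nth_map i) ?size_enum_ord ?nth_ord_enum.
  apply/(sortedP 0) => j; rewrite size_map size_enum_ord => jn.
  rewrite !(nth_map i) -?enumT ?size_enum_ord ?(ltnW jn) //.
  by apply: zs; rewrite !nth_enum_ord ?(ltnW jn).
by split=> //; apply: ge0; rewrite (perm_mem pe) map_f // mem_enum.
Qed.

Lemma absmx_spectral n (A : 'M[C]_n) : exists2 E : 'M[C]_n, E \is unitarymx &
  [/\ absmx A = E *m diag_mx (\row_(i < n) sv A i.+1) *m E^H,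
     forall i : 'I_n, 0 <= sv A i.+1 &
     forall i j : 'I_n, (i <= j)%N -> sv A j.+1 <= sv A i.+1].
Proof.
have [F [h [hF h0 _ hA _]]] := absmxE A.
have Dh : (absmx A)^H = absmx A.
  by rewrite hA conj_diag_real // => i; rewrite mxE ger0_real // sqrtC_ge0.
have [E [z [hE hz zs]]] := spectral_sorted (hermitian_normal Dh).
(* The diagonal matrix [E^H *m absmx A *m E] is self-adjoint; with real entries [lexge] implies the
   usual order. *)
have zr i : z 0 i \is Num.real.
  have /matrixP/(_ i i) : diag_mx z = diag_mx (map_mx conjC z).
    rewrite -adjmx_diag; have -> : diag_mx z = E^H *m absmx A *m E.
      rewrite hz !mulmxA unitary_mulVmx // mul1mx -mulmxA.
      by rewrite unitary_mulVmx // mulmx1.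
    by rewrite adjmxM (adjmxM E^H) adjmxK Dh mulmxA.
  by rewrite !mxE eqxx !mulr1n => /esym/CrealP.
have zs' (i j : 'I_n) : (i <= j)%N -> z 0 j <= z 0 i.
  by move=> /zs/lexge_Re; rewrite !(Creal_ReP _ (zr _)).
have svz := sing_valsE hE hz zs'.
exists E => //; split.
- rewrite {1}hz; congr (_ *m diag_mx _ *m _); apply/rowP=> i.
  by rewrite [RHS]mxE; have [-> _] := svz i.
- by move=> i; have [-> ] := svz i.
- by move=> i j ij; have [-> _] := svz i; have [-> _] := svz j; apply: zs'.
Qed.

End Spectrum.

(** * Ky Fan's variational principle *)

Section KyFan.
Variable C : numClosedFieldType.

Lemma Re_le_norm (z : C) : 'Re z <= `|z|.
Proof.
apply: le_trans (leif_normC_Re_Creal z).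
exact: real_ler_norm (Creal_Re z).
Qed.

Lemma Re_mul_conj_le (x y : C) :
  'Re (x * y^*) <= 2^-1 * (`|x| ^+ 2 + `|y| ^+ 2).
Proof.
rewrite -subr_ge0; have -> : 2^-1 * (`|x| ^+ 2 + `|y| ^+ 2) - 'Re (x * y^*) =
    2^-1 * `|x - y| ^+ 2.
  by rewrite ReE !normCK rmorphM rmorphB /= conjCK; field.
by rewrite mulr_ge0 ?exprn_ge0 ?invr_ge0 ?ler0n.
Qed.

Definition selmx n k (f : 'I_k -> 'I_n) : 'M[C]_(n, k) :=
  \matrix_(i, j) (i == f j)%:R.

Lemma mulmx_sel m n k (f : 'I_k -> 'I_n) (A : 'M[C]_(m, n)) i j :
  (A *m selmx f) i j = A i (f j).
Proof.
rewrite mxE (bigD1 (f j)) //= mxE eqxx mulr1 big1 ?addr0 // => l lj.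
by rewrite mxE (negPf lj) mulr0.
Qed.

Lemma adj_sel_mulmx m n k (f : 'I_k -> 'I_n) (A : 'M[C]_(n, m)) i j :
  ((selmx f)^H *m A) i j = A (f i) j.
Proof.
rewrite -[A in LHS]adjmxK -adjmxM adjmxE mulmx_sel.
by rewrite adjmxE conjCK.
Qed.

Lemma selmx_isometry n k (f : 'I_k -> 'I_n) : injective f ->
  (selmx f)^H *m selmx f = 1%:M.
Proof.
move=> finj; apply/matrixP=> i j.
by rewrite adj_sel_mulmx !mxE (inj_eq finj).
Qed.

Lemma trace_sel n k (f : 'I_k -> 'I_n) (M : 'M[C]_n) :
  \tr ((selmx f)^H *m M *m selmx f) = \sum_i M (f i) (f i).
Proof. by apply: eq_bigr => i _; rewrite mulmx_sel adj_sel_mulmx. Qed.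

Lemma kyfanE n k (A : 'M[C]_n) : kyfan k A = \sum_(i < k) sv A i.+1.
Proof. by rewrite /kyfan big_add1 big_mkord. Qed.

Definition first_set n k : {set 'I_n} := [set i : 'I_n | (i < k)%N].

Lemma sum_first_set n k (kn : (k <= n)%N) (x : 'I_n -> C) :
  \sum_(i in first_set n k) x i = \sum_(i < k) x (widen_ord kn i).
Proof.
rewrite (eq_bigl (fun i : 'I_n => (i < k)%N)); first by rewrite (big_ord_narrow kn).
by move=> i; rewrite inE.
Qed.

Lemma card_first_set n k : (k <= n)%N -> #|first_set n k| = k.
Proof.
move=> kn; rewrite -sum1_card (eq_bigl (fun i : 'I_n => (i < k)%N)).
  by rewrite (big_ord_narrow kn) sum1_card card_ord.
by move=> i; rewrite inE.
Qed.

Lemma adj_mul_eq0 m n (Y : 'M[C]_(m, n)) : Y^H *m Y = 0 -> Y = 0.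
Proof.
move=> h; apply/matrixP=> i j; have /matrixP/(_ j j) := h.
rewrite -inner_col inner_normE mxE => /eqP.
rewrite psumr_eq0 => [/allP/(_ i)|? _]; last by rewrite exprn_ge0.
by rewrite mem_index_enum !mxE expf_eq0 normr_eq0 /= => /(_ isT)/eqP.
Qed.

(* The singular vectors for the zero singular value are sent to zero, so [Z]
   is only a partial isometry; being a contraction is all that is needed. *)
Lemma singular_value_decomposition n (X : 'M[C]_n) :
  exists W : 'M[C]_n, exists Z : 'M[C]_n,
  [/\ W \is unitarymx, contraction Z,
      X = Z *m diag_mx (\row_(i < n) sv X i.+1) *m W^H &
      forall i : 'I_n, (Z^H *m Z) i i * sv X i.+1 = sv X i.+1].
Proof.
have [W hW [hX s0 _]] := absmx_spectral X; set s := \row__ _ in hX *.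
(* As the inverse of 0 is 0, this is the pseudo-inverse of [s]. *)
pose t : 'rV[C]_n := \row_i (s 0 i)^-1; set Y := X *m W.
have sr i : s 0 i \is Num.real by rewrite mxE ger0_real.
have tr i : t 0 i \is Num.real by rewrite mxE rpredV.
have YY : Y^H *m Y = diag_mx s *m diag_mx s.
  rewrite adjmxM mulmxA -[_ *m X]mulmxA -absmx_sqr hX.
  rewrite !mulmxA unitary_mulVmx // mul1mx -!mulmxA unitary_mulVmx // mulmx1.
  by rewrite [W^H *m (_ *m _)]mulmxA unitary_mulVmx // mul1mx.
have ZZ : (Y *m diag_mx t)^H *m (Y *m diag_mx t) =
    diag_mx (\row_i (s 0 i != 0)%:R).
  rewrite adjmxM adjmx_diag_real // mulmxA -[_ *m _ *m Y]mulmxA YY.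
  rewrite !mulmx_diag; congr diag_mx; apply/rowP=> i; rewrite !mxE.
  have [->|si] := eqVneq (sv X i.+1) 0; first by rewrite !(mulr0, mul0r).
  by rewrite mulKf // mulfV.
exists W, (Y *m diag_mx t); split=> //.
- move=> x; rewrite inner_adj mulmxA ZZ inner_normE /inner mxE; apply: ler_sum => i _.
  rewrite mul_diag_mx !mxE rmorphM /= conjC_nat -mulrA [_^* * _]mulrC -normCK.
  by case: eqP => _; rewrite ?mul1r // mul0r exprn_ge0.
- have -> : Y *m diag_mx t *m diag_mx s = Y.
    (* The two sides can differ only in columns with singular value 0, and by [YY] such columns of
       [Y] have norm 0. *)
    apply/eqP; rewrite -subr_eq0; apply/eqP/adj_mul_eq0.
    rewrite -mulmxA mulmx_diag -{2 4}[Y]mulmx1 -diag_const_mx -mulmxBr -raddfB /=.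
    rewrite adjmxM mulmxA -[_ *m _ *m Y]mulmxA YY adjmx_diag !mulmx_diag.
    apply/matrixP=> i j; rewrite !mxE.
    have [->|si] := eqVneq (sv X i.+1) 0; first by rewrite !(mulr0,mul0r) mul0rn.
    by rewrite mulVf // subrr rmorph0 !mul0r mul0rn.
  by rewrite -mulmxA unitary_mulmxV // mulmx1.
- move=> i; rewrite ZZ !mxE eqxx mulr1n.
  by have [->|_] := eqVneq (sv X i.+1) 0; rewrite ?mul1r ?mulr0.
Qed.

(** By AM-GM the trace is at most the sum of s j c j, where c j averages the squared norms of the
    j-th rows of [a] and [b]. Rows and columns of contractions have norm at most 1, so the c j lie
    in [0, 1] and have total at most k; [weighted_sum_le] applies. *)
Lemma trace_adj_mul_le n k (s : 'I_n -> C) (r : C) (S : {set 'I_n})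
    (a b : 'M[C]_(n, k)) :
  (forall i, 0 <= s i) -> 0 <= r ->
  (forall j, j \in S -> r <= s j) -> (forall j, j \notin S -> s j <= r) ->
  #|S| = k -> contraction a -> contraction b ->
  'Re (\tr (b^H *m diag_mx (\row_i s i) *m a)) <= \sum_(j in S) s j.
Proof.
move=> s0 r0 Sr Snr cardS ca cb.
pose c j := 2^-1 * (\sum_i `|a j i| ^+ 2 + \sum_i `|b j i| ^+ 2).
have half0 : 0 <= 2^-1 :> C by rewrite invr_ge0 ler0n.
have n0 (A : 'M[C]_(n, k)) j : 0 <= \sum_i `|A j i| ^+ 2.
  by rewrite sumr_ge0 // => i _; rewrite exprn_ge0.
apply: (@le_trans _ _ (\sum_j s j * c j)); last first.
  apply: (weighted_sum_le r0 Sr Snr) => [j|].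
    rewrite mulr_ge0 ?addr_ge0 //= /c -[X in _ <= X](mulVf (_ : 2 != 0 :> C)) ?pnatr_eq0 //.
    by rewrite ler_wpM2l // -[2]/(1 + 1) lerD // contraction_row.
  have colsum (A : 'M[C]_(n, k)) : contraction A ->
      \sum_j \sum_i `|A j i| ^+ 2 <= k%:R.
    move=> cA; rewrite exchange_big /= -[X in X%:R]card_ord -sum1_card natr_sum.
    by rewrite ler_sum // => i _; apply: contraction_col.
  rewrite -mulr_sumr big_split /= cardS -[X in _ <= X](mulKf (_ : 2 != 0 :> C)) ?pnatr_eq0 //.
  by rewrite ler_wpM2l // mulr_natl mulr2n lerD // colsum.
rewrite mxtrace_mulC mulmxA mxtrace_mulC.
rewrite /mxtrace raddf_sum ler_sum // => j _ /=.
rewrite mul_diag_mx !mxE.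
rewrite (ReMl (ger0_real (s0 j))) ler_wpM2l // raddf_sum /= /c -big_split /= mulr_sumr.
by apply: ler_sum => i _; rewrite adjmxE; apply: Re_mul_conj_le.
Qed.

(** The singular value decomposition reduces the trace to the diagonal case, between the
    contractions [W^H *m P] and [Z^H *m Q], with threshold s_k. *)
Lemma kyfan_ge n k (X : 'M[C]_n) (P Q : 'M[C]_(n, k)) : (0 < k <= n)%N ->
  contraction P -> contraction Q -> 'Re (\tr (Q^H *m X *m P)) <= kyfan k X.
Proof.
move=> /andP[k0 kn] cP cQ; have [W [Z [hW cZ hX _]]] := singular_value_decomposition X.
have [_ _ [_ s0 sdec]] := absmx_spectral X.
rewrite kyfanE -(sum_first_set kn (fun i => sv X i.+1)).
have lastk : (k.-1 < n)%N by rewrite prednK.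
have -> : Q^H *m X *m P = (Z^H *m Q)^H *m diag_mx (\row_(i < n) sv X i.+1) *m (W^H *m P).
  by rewrite {1}hX adjmxM adjmxK !mulmxA.
apply: (trace_adj_mul_le (r := sv X (Ordinal lastk).+1)) => //.
- by move=> j; rewrite inE => jk; apply: sdec; rewrite /= -ltnS prednK.
- by move=> j; rewrite inE -leqNgt => kj; apply: sdec; rewrite /= (leq_trans (leq_pred _)).
- exact: card_first_set.
- by apply: contractionM cP; apply: contraction_unitary (adjmx_unitary hW).
- by apply: contractionM cQ; apply: contraction_adj.
Qed.

(** Take the first k columns of [W] and [Z]. Where a column of [Z] is not a unit vector, the
    singular value is 0 and nothing is lost. *)
Lemma kyfan_attained n k (X : 'M[C]_n) : (k <= n)%N ->
  exists P : 'M[C]_(n, k), exists Q : 'M[C]_(n, k),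
  [/\ contraction P, contraction Q & \tr (Q^H *m X *m P) = kyfan k X].
Proof.
move=> kn; have [W [Z [hW cZ hX hZ]]] := singular_value_decomposition X.
pose J := selmx (widen_ord kn).
have cJ : contraction J.
  apply/isometry_contraction/selmx_isometry => i j /(congr1 val) /= ij.
  exact: val_inj.
exists (W *m J), (Z *m J); split.
- exact: contractionM (contraction_unitary hW) cJ.
- exact: contractionM cZ cJ.
rewrite adjmxM {1}hX; set D := diag_mx _.
have -> : J^H *m Z^H *m (Z *m D *m W^H) *m (W *m J) = J^H *m (Z^H *m Z *m D) *m J.
  by rewrite !mulmxA -[_ *m W^H *m W]mulmxA unitary_mulVmx // mulmx1.
rewrite trace_sel kyfanE; apply: eq_bigr => i _.
rewrite mul_mx_diag [LHS]mxE -[RHS](hZ (widen_ord kn i)); congr (_ * _); exact: mxE.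
Qed.

End KyFan.

(** * A basis adapted to both |A| and a hermitian matrix *)

Section Adapted.
Variable C : numClosedFieldType.

Lemma Im_conjE (z : C) : 'Im z = (z - z^*) / (2 * 'i).
Proof.
rewrite {2 3}[z]Crect conjC_rect ?Creal_Re ?Creal_Im //.
by field; rewrite neq0Ci.
Qed.

(* Pinching [M] to the eigenspaces of [|A|] yields a hermitian [M'] commuting
   with [|A|], so a unitary diagonalization of the normal matrix [|A| + iM']
   diagonalizes both; the rest of [M] has no entry inside an eigenspace. *)
Lemma adapted_basis n (A M : 'M[C]_n) : M^H = M ->
  exists2 E : 'M[C]_n, E \is unitarymx &
  [/\ absmx A = E *m diag_mx (\row_(i < n) sv A i.+1) *m E^H,
      (forall i j : 'I_n, i != j -> sv A i.+1 = sv A j.+1 ->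
         (E^H *m M *m E) i j = 0) &
      (forall i j : 'I_n, (i <= j)%N -> sv A i.+1 = sv A j.+1 ->
         (E^H *m M *m E) j j <= (E^H *m M *m E) i i)].
Proof.
move=> hM; have [E0 hE0 [hA s0 _]] := absmx_spectral A.
set s := \row__ _ in hA.
have sr i : s 0 i \is Num.real by rewrite mxE ger0_real.
pose M1 := E0^H *m M *m E0.
have hM1 : M1^H = M1 by rewrite !adjmxM adjmxK hM mulmxA.
pose M2 : 'M[C]_n := \matrix_(i, j) if s 0 i == s 0 j then M1 i j else 0.
have hM2 : M2^H = M2.
  apply/matrixP=> i j; have M1ji : (M1 j i)^* = M1 i j by rewrite -adjmxE hM1.
  rewrite adjmxE [M2 i j]mxE [M2 j i]mxE eq_sym -M1ji.
  by case: eqP => _ //; rewrite rmorph0.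
have cM2 : diag_mx s *m M2 = M2 *m diag_mx s.
  apply/matrixP=> i j; rewrite mul_diag_mx mul_mx_diag !mxE.
  by case: eqP => [->|_]; rewrite ?mulr0 ?mul0r // mulrC.
pose N := diag_mx s + 'i *: M2.
have hN : N^H = diag_mx s - 'i *: M2.
  by rewrite adjmxD adjmxZ adjmx_diag_real // hM2 conjCi scaleNr.
have : N \is normalmx.
  apply/normalmxP; rewrite -adjmx_trC hN /N.
  rewrite !(mulmxDl, mulmxDr, mulmxBl, mulmxBr, mulmxN, mulNmx).
  rewrite -!scalemxAl -!scalemxAr cM2.
  by rewrite !addrA; congr (_ - _); rewrite addrAC.
move=> /spectral_sorted [E1 [z [hE1 hz zs]]].
have hz' : N^H = E1 *m diag_mx (map_mx conjC z) *m E1^H.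
  by rewrite hz !adjmxM adjmxK adjmx_diag mulmxA.
have diagZ (a : C) (y : 'rV[C]_n) : a *: diag_mx y = diag_mx (a *: y) by rewrite linearZ.
have diagD (x y : 'rV[C]_n) : diag_mx x + diag_mx y = diag_mx (x + y) by rewrite linearD.
have sRe : diag_mx s = E1 *m diag_mx (map_mx (@Re C) z) *m E1^H.
  have -> : diag_mx s = 2^-1 *: (N + N^H).
    by rewrite hN /N addrACA subrr addr0 -mulr2n -scaler_nat scalerA mulVf ?pnatr_eq0 ?scale1r.
  rewrite hz' hz -mulmxDl -mulmxDr scalemxAl scalemxAr diagD diagZ.
  by congr (_ *m diag_mx _ *m _); apply/rowP=> i; rewrite !mxE ReE mulrC.
have M2Im : M2 = E1 *m diag_mx (map_mx (@Im C) z) *m E1^H.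
  have -> : M2 = (2 * 'i)^-1 *: (N - N^H).
    rewrite hN /N opprB addrC addrA addrNK -mulr2n -scaler_nat !scalerA.
    by rewrite mulVf ?scale1r // mulf_neq0 ?neq0Ci ?pnatr_eq0.
  rewrite hz' hz -mulmxBl -mulmxBr scalemxAl scalemxAr -raddfB /= diagZ.
  by congr (_ *m diag_mx _ *m _); apply/rowP=> i; rewrite !mxE Im_conjE mulrC.
have hE : E0 *m E1 \is unitarymx by apply: mul_unitarymx.
have AE : absmx A = E0 *m E1 *m diag_mx (map_mx (@Re C) z) *m (E0 *m E1)^H.
  by rewrite hA sRe adjmxM !mulmxA.
(* The real parts come out decreasing, so they are the singular values in their own order. *)
have zRe : map_mx (@Re C) z = s.
  apply/rowP=> i; have [|<- _] := sing_valsE hE AE _ i; last by rewrite mxE.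
  by move=> a b ab; rewrite !mxE; apply/lexge_Re/zs.
have E1s : diag_mx s *m E1 = E1 *m diag_mx s.
  by rewrite {1}sRe zRe -mulmxA unitary_mulVmx // mulmx1.
(* Commuting with [diag_mx s], the matrix [E1] does not mix eigenspaces, so inside one of them [M1]
   may be replaced by [M2]. *)
have E1_0 a j : s 0 a != s 0 j -> E1 a j = 0.
  move=> saj; have /matrixP/(_ a j) := E1s.
  rewrite mul_diag_mx mul_mx_diag !mxE mulrC => /eqP.
  rewrite -subr_eq0 -mulrBr mulf_eq0 subr_eq0 => /orP[/eqP //|h].
  by move: saj; rewrite !mxE h.
have ME j l : s 0 j = s 0 l ->
    ((E0 *m E1)^H *m M *m (E0 *m E1)) j l = (diag_mx (map_mx (@Im C) z)) j l.
  move=> sjl; have -> : (E0 *m E1)^H *m M *m (E0 *m E1) = E1^H *m M1 *m E1.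
    by rewrite adjmxM /M1 !mulmxA.
  have -> : diag_mx (map_mx (@Im C) z) = E1^H *m M2 *m E1.
    rewrite M2Im !mulmxA unitary_mulVmx // mul1mx -mulmxA.
    by rewrite unitary_mulVmx // mulmx1.
  rewrite [LHS]mxE [RHS]mxE; apply: eq_bigr => b _.
  rewrite [X in X * _ = _]mxE [X in _ = X * _]mxE !big_distrl; apply: eq_bigr => a _ /=.
  rewrite [M2 a b]mxE; case: eqP => // /eqP sab; rewrite adjmxE.
  have [saj|/E1_0->] := eqVneq (s 0 a) (s 0 j); last by rewrite rmorph0 !mul0r.
  have [sbl|/E1_0->] := eqVneq (s 0 b) (s 0 l); last by rewrite !mulr0.
  by case/eqP: sab; rewrite saj sjl sbl.
exists (E0 *m E1) => //; split.
- by rewrite {1}AE zRe.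
- move=> i j ij sij; rewrite ME; last by rewrite !mxE.
  by rewrite mxE (negPf ij).
- move=> i j ij sij; rewrite !ME // ![diag_mx _ _ _]mxE !eqxx !mulr1n ![map_mx _ _ _ _]mxE.
  have := zs i j ij; rewrite /lexge.
  have Rz l : 'Re (z 0 l) = sv A l.+1 by have /rowP/(_ l) := zRe; rewrite !mxE.
  by rewrite !Rz sij ltxx eqxx.
Qed.

End Adapted.

(** * First-order expansion of the Ky Fan norm *)

Section FirstOrder.
Variable C : numClosedFieldType.

Lemma half_gt0 : 0 < 2^-1 :> C.
Proof. by rewrite invr_gt0 ltr0n. Qed.

Lemma conj_half : (2^-1)^* = 2^-1 :> C.
Proof. by rewrite conj_Creal // gtr0_real // half_gt0. Qed.

Lemma weighted_amgm (h a b : C) : 0 < h -> a \is Num.real -> b \is Num.real ->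
  a * b <= 2^-1 * (h^-1 * a ^+ 2 + h * b ^+ 2).
Proof.
move=> h0 ar br; rewrite -subr_ge0.
have -> : 2^-1 * (h^-1 * a ^+ 2 + h * b ^+ 2) - a * b =
    2^-1 * h^-1 * (a - h * b) ^+ 2 by field; rewrite gt_eqF.
apply: mulr_ge0; first by rewrite mulr_ge0 // ?invr_ge0 ?ler0n ?(ltW h0).
by rewrite real_exprn_even_ge0 // rpredB // rpredM // gtr0_real.
Qed.

Lemma gram_diagE m n (x : 'M[C]_(m, n)) j : (x *m x^H) j j = \sum_i `|x j i| ^+ 2.
Proof. by rewrite mxE; apply: eq_bigr => i _; rewrite adjmxE normCK. Qed.

Lemma gram_ge0 m n (x : 'M[C]_(m, n)) j : 0 <= (x *m x^H) j j.
Proof. by rewrite gram_diagE sumr_ge0 // => i _; rewrite exprn_ge0. Qed.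

(** Cauchy-Schwarz with a free weight [h] in place of square roots; [h] is fixed only at the end. *)
Lemma cross_gram_le m n (x y : 'M[C]_(m, n)) h j l : 0 < h ->
  `|(x *m y^H) j l| <= 2^-1 * (h^-1 * (x *m x^H) j j + h * (y *m y^H) l l).
Proof.
move=> h0; rewrite mxE !gram_diagE (le_trans (ler_norm_sum _ _ _)) //.
rewrite !mulr_sumr -big_split /= mulr_sumr ler_sum // => i _.
by rewrite normrM adjmxE norm_conjC weighted_amgm ?normr_real.
Qed.

(** Applying p to column j of p^H gives column j of p p^H, whose squared norm is therefore at most
    its diagonal entry; remove the square of that entry. *)
Lemma gram_offdiag_le m n (p : 'M[C]_(m, n)) j l : contraction p -> l != j ->
  `|(p *m p^H) l j| ^+ 2 <= (p *m p^H) j j * (1 - (p *m p^H) j j).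
Proof.
move=> cp lj; have := cp (col j p^H).
rewrite inner_col adjmxK inner_normE (bigD1 l) //= (bigD1 j) 1?eq_sym //=.
have cE i : (p *m col j p^H) i 0 = (p *m p^H) i j.
  by rewrite !mxE; apply: eq_bigr => a _; rewrite !mxE.
rewrite !cE (ger0_norm (gram_ge0 p j)) => h.
rewrite mulrBr mulr1 -expr2 lerBrDr; apply: le_trans h.
by rewrite addrA lerDl sumr_ge0 // => i _; rewrite exprn_ge0.
Qed.

Lemma Re_trace_mul_le n (N R : 'M[C]_n) r :
  (forall j l, N j l != 0 -> `|R l j| <= r) ->
  'Re (\tr (N *m R)) <= (\sum_j \sum_l `|N j l|) * r.
Proof.
move=> hR; apply: le_trans (Re_le_norm _) _.
rewrite (le_trans (ler_norm_sum _ _ _)) // mulr_suml ler_sum // => j _.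
rewrite mxE (le_trans (ler_norm_sum _ _ _)) // mulr_suml ler_sum // => l _.
rewrite normrM; have [->|/hR] := eqVneq (N j l) 0; first by rewrite normr0 !mul0r.
exact: ler_wpM2l.
Qed.

Lemma gap_exists n (d : 'I_n -> C) (s : C) : 0 < s ->
  exists2 g : C, 0 < g & g <= s /\ forall j, d j != s -> g <= `|d j - s|.
Proof.
(* The inverse of a sum of inverses is below each term, replacing a minimum; indices with [d j = s]
   contribute 0 to [T]. *)
move=> s0; pose T := \sum_j `|d j - s|^-1.
have T0 : 0 <= T by rewrite sumr_ge0 // => j _; rewrite invr_ge0.
have sV : 0 < s^-1 by rewrite invr_gt0.
have ST : 0 < s^-1 + T by rewrite ltr_wpDr.
exists (s^-1 + T)^-1; first by rewrite invr_gt0.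
split=> [|j dj]; first by rewrite -[leRHS]invrK lef_pV2 ?posrE // lerDl.
have dj0 : 0 < `|d j - s| by rewrite normr_gt0 subr_eq0.
rewrite -[leRHS]invrK lef_pV2 ?posrE ?invr_gt0 //.
rewrite ler_wpDl ?(ltW sV) // /T (bigD1 j) //= lerDl sumr_ge0 // => i _.
by rewrite invr_ge0.
Qed.

Section Expansion.
Variables (n k : nat) (d : 'I_n -> C) (S : {set 'I_n}) (s : C).
Hypotheses (d0 : forall j, 0 <= d j) (s0 : 0 < s) (cardS : #|S| = k).
Hypotheses (Sd : forall j, j \in S -> s <= d j) (Snd : forall j, j \notin S -> d j <= s).
Variables (g : C) (g0 : 0 < g) (gs : g <= s).
Hypothesis gd : forall j, d j != s -> g <= `|d j - s|.
Variables (u v : 'M[C]_(n, k)) (cu : contraction u) (cv : contraction v).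

(** Since [u = p + q] and [v = p - q], the matrix [u *m v^H] is [P] up to terms containing [q]. *)
Let p := 2^-1 *: (u + v).
Let q := 2^-1 *: (u - v).
Let P := p *m p^H.
Let Q := q *m q^H.
Let delta := k%:R - \sum_j P j j.
(** Missing trace plus deviation of the diagonal of [P] from the indicator of [S]. The eigenspace of
    [s] is exempt, as moving weight inside it does not change the main term. *)
Let omega := delta + \sum_(j | d j != s) slack S (fun j => P j j) j.

Lemma contraction_mid : contraction p. Proof. exact: contraction_half. Qed.

Lemma gram_mid_bounds j : 0 <= P j j <= 1.
Proof.
by rewrite gram_ge0 /= gram_diagE; apply: contraction_row; apply: contraction_mid.
Qed.

(** By the parallelogram law the traces of [P] and [Q] add up to the mean of those of u u^H and v
    v^H, each at most k. *)
Lemma sumQ_le : \sum_j Q j j <= delta.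
Proof.
rewrite lerBrDr -big_split /=.
have cols (A : 'M[C]_(n, k)) : contraction A -> \sum_j (A *m A^H) j j <= k%:R.
  move=> cA; under eq_bigr do rewrite gram_diagE.
  rewrite exchange_big /= -[X in X%:R]card_ord -sum1_card natr_sum.
  by rewrite ler_sum // => i _; apply: contraction_col.
have -> : \sum_j (Q j j + P j j) =
    2^-1 * (\sum_j (u *m u^H) j j + \sum_j (v *m v^H) j j).
  rewrite -big_split mulr_sumr; apply: eq_bigr => j _ /=.
  rewrite !gram_diagE -!big_split mulr_sumr; apply: eq_bigr => i _ /=.
  by rewrite !normCK !mxE !rmorphM !rmorphD rmorphN /= conj_half; field.
rewrite -[leRHS](mulKf (_ : 2 != 0 :> C)) ?pnatr_eq0 //.
by rewrite ler_wpM2l ?(ltW half_gt0) // mulr_natl mulr2n lerD // cols.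
Qed.

Lemma Q_ge0 j : 0 <= Q j j. Proof. exact: gram_ge0. Qed.

Lemma Q_le j : Q j j <= delta.
Proof.
apply: le_trans sumQ_le; rewrite (bigD1 j) //= lerDl sumr_ge0 // => i _.
exact: Q_ge0.
Qed.

Lemma delta_ge0 : 0 <= delta.
Proof. by apply: le_trans sumQ_le; rewrite sumr_ge0 // => i _; apply: Q_ge0. Qed.

Lemma slackP_ge0 j : 0 <= slack S (fun j => P j j) j.
Proof. exact/slack_ge0/gram_mid_bounds. Qed.

Lemma delta_le_omega : delta <= omega.
Proof. by rewrite lerDl sumr_ge0 // => j _; apply: slackP_ge0. Qed.

Lemma omega_ge0 : 0 <= omega.
Proof. exact: le_trans delta_ge0 delta_le_omega. Qed.

Lemma slack_le_omega j : d j != s -> slack S (fun j => P j j) j <= omega.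
Proof.
move=> dj; rewrite /omega (bigD1 j) //= addrCA lerDl.
by rewrite addr_ge0 ?delta_ge0 // sumr_ge0 // => i _; apply: slackP_ge0.
Qed.

(** The product P_jj (1 - P_jj) is at most either factor, and one of them is the slack. *)
Lemma offdiagP_le j l : l != j -> d j != s -> `|P l j| ^+ 2 <= omega.
Proof.
move=> lj /slack_le_omega; apply: le_trans.
apply: le_trans (gram_offdiag_le contraction_mid lj) _; have /andP[P0 P1] := gram_mid_bounds j.
rewrite /slack; case: (j \in S).
  by rewrite ler_piMl // subr_ge0.
by rewrite ler_piMr // gerBl.
Qed.

(** The cross terms form a skew-hermitian matrix, so they vanish from the real part of the
    diagonal. *)
Lemma uvE : u *m v^H = P + (q *m p^H - p *m q^H - Q).
Proof.
have -> : u = p + q by apply/matrixP=> i j; rewrite !mxE; field.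
have -> : v = p - q by apply/matrixP=> i j; rewrite !mxE; field.
by rewrite adjmxB mulmxDl !mulmxBr -!addrA; congr (_ + _); rewrite addrCA.
Qed.

(** The cross terms obey [cross_gram_le], where [Q] has diagonal at most [delta] and [P] at most 1;
    [h] trades a constant error against a multiple of the defect. *)
Lemma remainder_le h j l : 0 < h ->
  `|(u *m v^H - P) j l| <= h + (1 + h^-1) * omega.
Proof.
move=> h0; rewrite uvE addrAC subrr add0r.
have hV : 0 <= h^-1 by rewrite invr_ge0 ltW.
have pq1 : `|(q *m p^H) j l| <= 2^-1 * (h^-1 * delta + h).
  apply: le_trans (cross_gram_le _ _ _ _ h0) _.
  rewrite ler_wpM2l ?(ltW half_gt0) // lerD ?ler_wpM2l ?Q_le //.
  by rewrite ger_pMr //; case/andP: (gram_mid_bounds l).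
have pq2 : `|(p *m q^H) j l| <= 2^-1 * (h^-1 * delta + h).
  have hV0 : 0 < h^-1 by rewrite invr_gt0.
  apply: le_trans (cross_gram_le _ _ _ _ hV0) _.
  rewrite ler_wpM2l ?(ltW half_gt0) // invrK addrC lerD ?ler_wpM2l ?Q_le //.
  by rewrite ger_pMr //; case/andP: (gram_mid_bounds j).
have qq : `|Q j l| <= delta.
  apply: le_trans (cross_gram_le _ _ _ _ ltr01) _.
  rewrite invr1 !mul1r -[leRHS](mulKf (_ : 2 != 0 :> C)) ?pnatr_eq0 //.
  by rewrite ler_wpM2l ?(ltW half_gt0) // mulr_natl mulr2n lerD // Q_le.
have -> : (q *m p^H - p *m q^H - Q) j l =
    (q *m p^H) j l - (p *m q^H) j l - Q j l by rewrite !mxE.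
apply: (@le_trans _ _ (h + (1 + h^-1) * delta)); last first.
  by rewrite lerD2l ler_wpM2l ?addr_ge0 // delta_le_omega.
apply: le_trans (ler_normB _ _) _.
apply: le_trans (lerD (ler_normB _ _) (lexx _)) _.
apply: le_trans (lerD (lerD pq1 pq2) qq) _.
by rewrite le_eqVlt; apply/orP; left; apply/eqP; field; rewrite gt_eqF.
Qed.

(** In [weighted_sumE] with threshold [s], missing trace costs s >= g per unit, and slack outside
    the eigenspace costs |d j - s| >= g per unit. *)
Lemma diag_part_le :
  'Re (\tr (diag_mx (\row_j d j) *m (u *m v^H))) <= \sum_(j in S) d j - g * omega.
Proof.
apply: (@le_trans _ _ (\sum_j d j * P j j)).
  rewrite /mxtrace raddf_sum ler_sum // => j _ /=.
  rewrite mul_diag_mx mxE [in X in X * _]mxE (ReMl (ger0_real (d0 j))) ler_wpM2l //.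
  have -> : (u *m v^H) j j =
      P j j + ((q *m p^H) j j - (p *m q^H) j j - Q j j) by rewrite uvE !mxE.
  have -> : (p *m q^H) j j = ((q *m p^H) j j)^*.
    by rewrite -adjmxE adjmxM adjmxK.
  rewrite !raddfD !raddfN /= Re_conj subrr add0r.
  rewrite (Creal_ReP _ (ger0_real (Q_ge0 j))).
  rewrite (Creal_ReP _ (ger0_real (proj1 (andP (gram_mid_bounds j))))).
  by rewrite gerBl Q_ge0.
rewrite (weighted_sumE S d (fun j => P j j) s) cardS -/delta.
rewrite -addrA -opprD lerD2l lerN2 mulrDr lerD ?ler_wpM2r ?delta_ge0 //.
rewrite mulr_sumr big_mkcond ler_sum // => j _.
have -> : (-1) ^+ (j \notin S) * (d j - s) = `|d j - s|.
  have [jS|jS] := boolP (j \in S).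
    by rewrite mul1r ger0_norm // subr_ge0 Sd.
  by rewrite expr1 mulN1r ler0_norm // subr_le0 Snd.
have [->|dj] := eqVneq (d j) s; first by rewrite subrr normr0 mul0r.
by rewrite /= ler_wpM2r ?slackP_ge0 // gd.
Qed.

(** Inside the eigenspace [mu] separates the entries, so slack there only lowers the sum; elsewhere
    slack is at most [omega]. *)
Lemma diag_pert_le (m : 'I_n -> C) (mu : C) :
  (forall j, m j \is Num.real) -> mu \is Num.real ->
  (forall j, j \in S -> d j = s -> mu <= m j) ->
  (forall j, j \notin S -> d j = s -> m j <= mu) ->
  \sum_j m j * P j j <=
  \sum_(j in S) m j + (`|mu| + \sum_j `|m j - mu|) * omega.
Proof.
move=> mr mur Sm Snm.
rewrite (weighted_sumE S m (fun j => P j j) mu) cardS -/delta.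
rewrite -addrA lerD2l mulrDl lerD //.
  apply: (@le_trans _ _ (`|mu| * delta)).
    by rewrite -mulNr ler_wpM2r ?delta_ge0 // -normrN real_ler_norm // rpredN.
  by rewrite ler_wpM2l // delta_le_omega.
rewrite -sumrN mulr_suml ler_sum // => j _.
have nn : 0 <= `|m j - mu| * omega by rewrite mulr_ge0 ?omega_ge0.
have [dj|dj] := eqVneq (d j) s.
  apply: le_trans nn; rewrite oppr_le0 mulr_ge0 ?slackP_ge0 //.
  have [jS|jS] := boolP (j \in S); first by rewrite mul1r subr_ge0 Sm.
  by rewrite expr1 mulN1r opprB subr_ge0 Snm.
apply: (@le_trans _ _ (`|m j - mu| * slack S (fun j => P j j) j)); last first.
  by rewrite ler_wpM2l // slack_le_omega.
rewrite -mulNr ler_wpM2r ?slackP_ge0 //.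
have r1 : (-1) ^+ (j \notin S) * (m j - mu) \is Num.real.
  by rewrite rpredM ?rpredX ?rpredN ?rpred1 // rpredB.
apply: le_trans (real_ler_norm _) _; first by rewrite rpredN.
by rewrite normrN normrM normrX normrN1 expr1n mul1r.
Qed.

(** A nonzero off-diagonal entry of [M] involves an index outside the eigenspace, where |P l j|^2 <=
    omega; AM-GM with weight [h] then bounds |P l j|. *)
Lemma offdiag_le (M : 'M[C]_n) h : 0 < h ->
  (forall j l, j != l -> d j = s -> d l = s -> M j l = 0) ->
  'Re (\tr (M *m P)) <= 'Re (\sum_j M j j * P j j) +
    (\sum_j \sum_l `|M j l|) * (h + (1 + h^-1) * omega).
Proof.
move=> h0 M0; pose R : 'M[C]_n := \matrix_(j, l) if j == l then 0 else P j l.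
have -> : \tr (M *m P) = \sum_j M j j * P j j + \tr (M *m R).
  rewrite -big_split; apply: eq_bigr => j _ /=.
  rewrite [LHS]mxE [X in _ = _ + X]mxE (bigD1 j) //=.
  congr (_ + _); rewrite [in RHS](bigD1 j) //= mxE eqxx mulr0 add0r.
  by apply: eq_bigr => l lj; rewrite [R l j]mxE (negPf lj).
rewrite raddfD lerD2l; apply: Re_trace_mul_le => j l Mjl.
have hV : 0 < h^-1 by rewrite invr_gt0.
have err0 : 0 <= h + (1 + h^-1) * omega.
  by rewrite addr_ge0 ?(ltW h0) // mulr_ge0 ?omega_ge0 // addr_ge0 // ltW.
rewrite mxE; have [_|lj] := eqVneq l j; first by rewrite normr0.
have Plj : `|P l j| ^+ 2 <= omega.
  have [dj|dj] := eqVneq (d j) s; last exact: offdiagP_le.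
  have [dl|dl] := eqVneq (d l) s.
    by move: Mjl; rewrite M0 ?eqxx // eq_sym.
  have -> : P l j = (P j l)^* by rewrite -adjmxE adjmxM adjmxK.
  by rewrite norm_conjC offdiagP_le // eq_sym.
rewrite -[`|_|]mulr1 (le_trans (weighted_amgm h0 (normr_real _) (real1 _))) //.
rewrite expr1n mulr1.
have half1 : 2^-1 <= 1 :> C by rewrite invf_le1 ?ltr0n // ler1n.
apply: (@le_trans _ _ (h^-1 * omega + h)).
  have le1 : h^-1 * `|P l j| ^+ 2 + h <= h^-1 * omega + h.
    by rewrite lerD2r ler_wpM2l // ltW.
  apply: le_trans le1; rewrite ler_piMl // addr_ge0 ?(ltW h0) //.
  by rewrite mulr_ge0 ?exprn_ge0 // ltW.
rewrite addrC lerD2l ler_wpM2r ?omega_ge0 //.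
by rewrite lerDr ler01.
Qed.

(** Against the hermitian [P] only the hermitian part of [N] counts; the difference between
    [u *m v^H] and [P] is charged to all of [N]. *)
Lemma pert_le (N : 'M[C]_n) (M := 2^-1 *: (N + N^H)) (mu h : C) : 0 < h ->
  mu \is Num.real ->
  (forall j l, j != l -> d j = s -> d l = s -> M j l = 0) ->
  (forall j, j \in S -> d j = s -> mu <= M j j) ->
  (forall j, j \notin S -> d j = s -> M j j <= mu) ->
  'Re (\tr (N *m (u *m v^H))) <= \sum_(j in S) M j j
    + (`|mu| + \sum_j `|M j j - mu|) * omega
    + (\sum_j \sum_l `|M j l| + \sum_j \sum_l `|N j l|) * (h + (1 + h^-1) * omega).
Proof.
move=> h0 mur M0 SM SnM.
have hM : M^H = M by rewrite adjmxZ conj_half adjmxD adjmxK addrC.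
have Mr j : M j j \is Num.real by apply/CrealP; rewrite -adjmxE hM.
have hP : P^H = P by rewrite adjmxM adjmxK.
have -> : u *m v^H = P + (u *m v^H - P) by rewrite addrC subrK.
rewrite mulmxDr mxtraceD raddfD /= [(_ + _) * (h + _)]mulrDl addrA lerD //; last first.
  by apply: Re_trace_mul_le => j l _; apply: remainder_le.
have -> : 'Re (\tr (N *m P)) = 'Re (\tr (M *m P)).
  rewrite -scalemxAl mxtraceZ mulmxDl mxtraceD.
  have -> : \tr (N^H *m P) = (\tr (N *m P))^*.
    by rewrite -mxtrace_adj adjmxM hP mxtrace_mulC.
  rewrite (ReMl (gtr0_real half_gt0)) raddfD /= Re_conj.
  by field.
apply: le_trans (offdiag_le h0 M0) _; rewrite lerD2r.
apply: le_trans (diag_pert_le Mr mur SM SnM).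
rewrite (Creal_ReP _ _) // rpred_sum // => j _.
by rewrite rpredM // ger0_real //; case/andP: (gram_mid_bounds j).
Qed.

End Expansion.

(** Loss and gain are both linear in the defect, so a [t] that depends only on their coefficients
    works for all [u] and [v] at once. *)
Lemma first_order_decrease n k (d : 'I_n -> C) (S : {set 'I_n}) (s mu : C)
    (N : 'M[C]_n) (M := 2^-1 *: (N + N^H)) :
  (forall j, 0 <= d j) -> 0 < s -> #|S| = k ->
  (forall j, j \in S -> s <= d j) -> (forall j, j \notin S -> d j <= s) ->
  mu \is Num.real ->
  (forall j l, j != l -> d j = s -> d l = s -> M j l = 0) ->
  (forall j, j \in S -> d j = s -> mu <= M j j) ->
  (forall j, j \notin S -> d j = s -> M j j <= mu) ->
  \sum_(j in S) M j j < 0 ->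
  exists2 t : C, 0 < t & forall u v : 'M[C]_(n, k), contraction u -> contraction v ->
    'Re (\tr (v^H *m (diag_mx (\row_j d j) + t *: N) *m u)) < \sum_(j in S) d j.
Proof.
move=> d0 s0 cardS Sd Snd mur M0 SM SnM a0.
have [g g0 [gs gd]] := gap_exists d s0.
pose K := `|mu| + \sum_j `|M j j - mu|.
pose b := \sum_j \sum_l `|M j l| + \sum_j \sum_l `|N j l|.
set a := \sum_(j in S) M j j in a0.
have K0 : 0 <= K by rewrite addr_ge0 // sumr_ge0.
have b0 : 0 <= b.
  by rewrite addr_ge0 //; apply: sumr_ge0 => j _; apply: sumr_ge0.
have b1 : 0 < b + 1 by rewrite ltr_wpDl // ltr01.
(* This keeps the constant error [b * h] below half of [- a]; the 1 in [b + 1] avoids a zero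
   divisor. *)
pose h := - a * 2^-1 * (b + 1)^-1.
have h0 : 0 < h by rewrite !mulr_gt0 ?oppr_gt0 // ?invr_gt0 // ltr0n.
have hV : 0 <= h^-1 by rewrite invr_ge0 ltW.
(* One more than the coefficient of the defect in [pert_le], so that [t * L = g] absorbs the whole
   gain from the defect. *)
pose L := K + b * (1 + h^-1) + 1.
have L0 : 0 < L.
  by rewrite ltr_wpDl ?ltr01 // addr_ge0 // mulr_ge0 // addr_ge0 // ler01.
pose t := g / L; have t0 : 0 < t by rewrite divr_gt0.
exists t => // u v cu cv.
pose p := 2^-1 *: (u + v).
pose w := k%:R - \sum_j (p *m p^H) j j
  + \sum_(j | d j != s) slack S (fun j => (p *m p^H) j j) j.
have w0 : 0 <= w by exact: (omega_ge0 d S s cu cv).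
have -> : 'Re (\tr (v^H *m (diag_mx (\row_j d j) + t *: N) *m u)) =
    'Re (\tr (diag_mx (\row_j d j) *m (u *m v^H)))
      + t * 'Re (\tr (N *m (u *m v^H))).
  rewrite -mulmxA mxtrace_mulC -mulmxA mulmxDl mxtraceD -scalemxAl mxtraceZ.
  by rewrite raddfD /= (ReMl (gtr0_real t0)).
have D := diag_part_le d0 cardS Sd Snd gs gd cu cv.
have H := pert_le cardS cu cv h0 mur M0 SM SnM.
rewrite -/p -/w in D H; rewrite -/M -/a -/K -/b in H.
apply: le_lt_trans (lerD D (ler_wpM2l (ltW t0) H)) _.
have bh : b * h <= - a * 2^-1.
  rewrite /h mulrCA ler_piMr ?mulr_ge0 ?oppr_ge0 ?(ltW a0) ?invr_ge0 ?ler0n //.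
  by rewrite ler_pdivrMr // mul1r lerDl ler01.
have tL : t * L = g by rewrite /t divfK // gt_eqF.
rewrite -subr_gt0.
set D0 := \sum_(j in S) d j.
have -> : D0 - (D0 - g * w + t * (a + K * w + b * (h + (1 + h^-1) * w))) =
    t * (- a * 2^-1 - b * h) + t * (- a * 2^-1) + t * w.
  by rewrite -tL /L; field; rewrite gt_eqF.
apply: ltr_wpDr; first by rewrite mulr_ge0 // ltW.
apply: ltr_wpDl; first by rewrite mulr_ge0 ?(ltW t0) // subr_ge0.
by rewrite mulr_gt0 // mulr_gt0 ?oppr_gt0 // half_gt0.
Qed.

End FirstOrder.

(** * The converse *)

Section Converse.
Variable C : numClosedFieldType.

Definition hermpart n (N : 'M[C]_n) := 2^-1 *: (N + N^H).

Lemma hermpart_adj n (N : 'M[C]_n) : (hermpart N)^H = hermpart N.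
Proof. by rewrite adjmxZ conj_half adjmxD adjmxK addrC. Qed.

Lemma hermpart_conj n (N E : 'M[C]_n) :
  hermpart (E^H *m N *m E) = E^H *m hermpart N *m E.
Proof.
rewrite /hermpart -scalemxAr -scalemxAl mulmxDr mulmxDl.
by rewrite !adjmxM adjmxK mulmxA.
Qed.

Lemma hermpartN n (N : 'M[C]_n) : hermpart (- N) = - hermpart N.
Proof.
rewrite /hermpart -scalerN opprD; congr (_ *: (_ + _)).
by apply/matrixP=> i j; rewrite !mxE rmorphN.
Qed.

Lemma Re_inner_hermpart n (N : 'M[C]_n) x :
  'Re (inner x (N *m x)) = inner x (hermpart N *m x).
Proof.
rewrite /hermpart -scalemxAl innerZr mulmxDl innerDr.
have -> : inner x (N^H *m x) = (inner x (N *m x))^*.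
  by rewrite inner_adj adjmxK inner_conj.
by rewrite ReE mulrC.
Qed.

Lemma threshold_sum_le n (x : 'I_n -> C) r (S T : {set 'I_n}) : 0 <= r ->
  (forall j, j \in T -> r <= x j) -> (forall j, j \notin T -> x j <= r) ->
  #|S| = #|T| -> \sum_(j in S) x j <= \sum_(j in T) x j.
Proof.
move=> r0 Tr Tnr ST; have -> : \sum_(j in S) x j = \sum_j x j * (j \in S)%:R.
  by rewrite big_mkcond; apply: eq_bigr => j _; case: ifP; rewrite ?mulr1 ?mulr0.
apply: (weighted_sum_le r0 Tr Tnr) => [j|].
  by case: (j \in S); rewrite ?lexx ?ler01.
rewrite -ST; have -> : \sum_j (j \in S)%:R = #|S|%:R :> C.
  by rewrite -natr_sum -sum1_card [in RHS]big_mkcond.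
exact: lexx.
Qed.

Lemma kyfan_ge0 n k (A : 'M[C]_n) : (k <= n)%N -> 0 <= kyfan k A.
Proof.
move=> kn; have [_ _ [_ s0 _]] := absmx_spectral A.
by rewrite kyfanE sumr_ge0 // => i _; apply: (s0 (widen_ord kn i)).
Qed.

(** Otherwise [first_order_decrease] yields t > 0 at which every pair of contractions stays below
    the sum over [S], itself at most [kyfan k A]. The maximizing pair for A + tB, moved to the basis
    [E], then contradicts minimality. *)
Lemma minimal_top_sum_ge0 n k (A B U E : 'M[C]_n) (S : {set 'I_n}) (mu : C)
    (M := E^H *m hermpart (U^H *m B) *m E) :
  (0 < k <= n)%N -> U \is unitarymx -> A = U *m absmx A -> E \is unitarymx ->
  absmx A = E *m diag_mx (\row_(i < n) sv A i.+1) *m E^H ->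
  0 < sv A k ->
  (forall i j : 'I_n, i != j -> sv A i.+1 = sv A j.+1 -> M i j = 0) ->
  #|S| = k ->
  (forall j : 'I_n, j \in S -> sv A k <= sv A j.+1) ->
  (forall j : 'I_n, j \notin S -> sv A j.+1 <= sv A k) ->
  mu \is Num.real ->
  (forall j : 'I_n, j \in S -> sv A j.+1 = sv A k -> mu <= M j j) ->
  (forall j : 'I_n, j \notin S -> sv A j.+1 = sv A k -> M j j <= mu) ->
  (forall t : C, t \is Num.real -> kyfan k A <= kyfan k (A + t *: B)) ->
  0 <= \sum_(j in S) M j j.
Proof.
move=> /andP[k0 kn] hU hA hE hD sk M0 cardS Sk Snk mur SM SnM hmin.
have [_ _ [_ s0 sdec]] := absmx_spectral A.
have hM : M^H = M by rewrite /M -hermpart_conj hermpart_adj.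
have Mr : \sum_(j in S) M j j \is Num.real.
  by apply: rpred_sum => j _; apply/CrealP; rewrite -adjmxE hM.
case: (real_leP (real0 _) Mr) => // neg.
pose N := E^H *m (U^H *m B) *m E.
have MN : M = 2^-1 *: (N + N^H) by rewrite /M -hermpart_conj.
rewrite MN in M0 SM SnM neg.
have M0' (j l : 'I_n) : j != l -> sv A j.+1 = sv A k -> sv A l.+1 = sv A k ->
    (2^-1 *: (N + N^H)) j l = 0 by move=> jl sj sl; apply: M0; rewrite // sj sl.
have [t t0 ht] := first_order_decrease s0 sk cardS Sk Snk mur M0' SM SnM neg.
have [P [Q [cP cQ PQ]]] := kyfan_attained (A + t *: B) kn.
have cEH := contraction_unitary (adjmx_unitary hE).
have cUH := contraction_unitary (adjmx_unitary hU).
have := ht _ _ (contractionM cEH cP) (contractionM cEH (contractionM cUH cQ)).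
have -> : (E^H *m (U^H *m Q))^H *m (diag_mx (\row_(j < n) sv A j.+1) + t *: N)
    *m (E^H *m P) = Q^H *m (A + t *: B) *m P.
  have -> : diag_mx (\row_(j < n) sv A j.+1) + t *: N =
      E^H *m U^H *m (A + t *: B) *m E.
    rewrite mulmxDr mulmxDl -scalemxAr -scalemxAl /N !mulmxA; congr (_ + _).
    have UA : U^H *m A = absmx A.
      by rewrite {1}hA mulmxA unitary_mulVmx // mul1mx.
    rewrite -(mulmxA _ _ A) UA {1}hD !mulmxA unitary_mulVmx // mul1mx -mulmxA.
    by rewrite unitary_mulVmx // mulmx1.
  rewrite !adjmxM !adjmxK !mulmxA -[_ *m E *m E^H]mulmxA unitary_mulmxV //.
  rewrite mulmx1 -[_ *m E *m E^H]mulmxA unitary_mulmxV // mulmx1.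
  by rewrite -[_ *m U *m U^H]mulmxA unitary_mulmxV // mulmx1.
rewrite PQ (Creal_ReP _ (ger0_real (kyfan_ge0 _ kn))) => lt1.
have lastk : (k.-1 < n)%N by rewrite prednK.
have := threshold_sum_le (x := fun i => sv A i.+1) (r := sv A k) (S := S)
  (T := first_set n k) (ltW sk).
rewrite (sum_first_set kn (fun i => sv A i.+1)) -kyfanE cardS card_first_set //.
have e : sv A (Ordinal lastk).+1 = sv A k by rewrite /= prednK.
move=> lt2; have: kyfan k (A + t *: B) < kyfan k A.
  apply: lt_le_trans lt1 (lt2 _ _ erefl) => j; rewrite inE => jk; rewrite -e.
    by apply: sdec; rewrite /= -ltnS prednK.
  by apply: sdec; rewrite /= (leq_trans (leq_pred _)) // leqNgt.
by move/lt_le_trans/(_ (hmin t (gtr0_real t0))); rewrite ltxx.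
Qed.

Lemma inner_delta n (M : 'M[C]_n) a b :
  inner (delta_mx a 0) (M *m delta_mx b 0) = M a b.
Proof.
rewrite -colE /inner mxE (bigD1 a) //= adjmxE !mxE !eqxx rmorph1 mul1r.
by rewrite big1 ?addr0 // => i ia; rewrite adjmxE !mxE (negPf ia) rmorph0 mul0r.
Qed.

Lemma convex_zero (V W : C) : W <= 0 -> 0 <= V ->
  exists2 l : C, 0 <= l <= 1 & l * V + (1 - l) * W = 0.
Proof.
move=> W0 V0; have VW : 0 <= V - W by rewrite subr_ge0 (le_trans W0).
(* If [V = W], both are 0 and so is the quotient. *)
exists (- W / (V - W)).
  rewrite mulr_ge0 ?oppr_ge0 ?invr_ge0 //=.
  have [->|nz] := eqVneq (V - W) 0; first by rewrite invr0 mulr0 ler01.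
  by rewrite ler_pdivrMr ?lt_def ?nz // mul1r lerDr.
have [e|nz] := eqVneq (V - W) 0; last by field.
rewrite e invr0 mulr0 mul0r add0r subr0 mul1r; apply/eqP.
by rewrite eq_le W0 /=; move/eqP: e; rewrite subr_eq0 => /eqP <-.
Qed.

End Converse.

Theorem theorem3p2 (C : numClosedFieldType) (n k : nat) (A B U : 'M[C]_n)
  (hk1 : (1 <= k)%N) (hkn : (k <= n)%N)
  (hU : U \is unitarymx) (hpolar : A = U *m absmx A) :
  let cond :=
    exists u : 'I_k -> 'cV[C]_n,
      [/\ (forall i j : 'I_k, inner (u i) (u j) = (i == j)%:R),
          (forall i : 'I_k, absmx A *m u i = sv A i.+1 *: u i) &
          \sum_(i < k) 'Re (inner (u i) (adjmx U *m B *m u i)) = 0] in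
  let concl := forall t : C, t \is Num.real -> kyfan k A <= kyfan k (A + t *: B) in
  (cond -> concl) /\ (0 < sv A k -> concl -> cond).
Proof.
move=> cond concl; split.
- move=> [u [uo ud uB]] t tr.
  pose P : 'M[C]_(n, k) := \matrix_(a, i) u i a 0.
  have colP i : col i P = u i by apply/colP=> a; rewrite !mxE.
  have PP : P^H *m P = 1%:M.
    by apply/matrixP=> i j; rewrite -inner_col !colP uo mxE.
  have cP := isometry_contraction PP.
  have k01 : (0 < k <= n)%N by rewrite hk1 hkn.
  apply: le_trans (kyfan_ge (A + t *: B) k01 cP (contractionM (contraction_unitary hU) cP)).
  have -> : (U *m P)^H *m (A + t *: B) *m P =
      P^H *m (absmx A *m P) + t *: (P^H *m (U^H *m B *m P)).
    rewrite adjmxM mulmxDr mulmxDl -scalemxAr -scalemxAl !mulmxA; congr (_ + _).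
    by rewrite {1}hpolar -!mulmxA [U^H *m (U *m _)]mulmxA unitary_mulVmx // mul1mx.
  rewrite mxtraceD mxtraceZ raddfD /= (ReMl tr).
  have trE (X : 'M[C]_n) : \tr (P^H *m (X *m P)) = \sum_i inner (u i) (X *m u i).
    by apply: eq_bigr => i _; rewrite -inner_col [col i (X *m P)]colE -mulmxA -colE !colP.
  rewrite !trE !raddf_sum /= uB mulr0 addr0 kyfanE.
  rewrite le_eqVlt; apply/orP; left; apply/eqP; apply: eq_bigr => i _.
  rewrite ud innerZr uo eqxx mulr1.
  have [_ _ [_ s0 _]] := absmx_spectral A.
  by rewrite (Creal_ReP _ (ger0_real (s0 (widen_ord hkn i)))).
move=> sk hmin; set s := sv A k in sk.
have hM := hermpart_adj (U^H *m B).
have [E hE [hD M0 Mdec]] := adapted_basis A hM.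
set M := E^H *m hermpart (U^H *m B) *m E in M0 Mdec.
have [_ _ [_ s0 sdec]] := absmx_spectral A.
have sdec' i j : (i <= j)%N -> (j < n)%N -> sv A j.+1 <= sv A i.+1.
  by move=> ij jn; apply: (sdec (Ordinal (leq_ltn_trans ij jn)) (Ordinal jn)).
have sE : sv A k.-1.+1 = s by rewrite prednK.
(* With positions counted from 0, [r] is the first and [e'] the last one carrying [s], so the
   eigenspace is the block [r, e), where r < k <= e. *)
have exs : exists i, sv A i.+1 == s by exists k.-1; rewrite sE.
have [r /eqP rs rmin] := ex_minnP exs.
have exe : exists i, (i < n)%N && (sv A i.+1 == s).
  by exists k.-1; rewrite sE eqxx prednK // hkn.
have ebnd i : (i < n)%N && (sv A i.+1 == s) -> (i <= n)%N by case/andP=> /ltnW.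
have [e' /andP[en /eqP es] emax] := ex_maxnP exe ebnd.
pose e := e'.+1.
have rk : (r < k)%N by have := rmin k.-1; rewrite sE eqxx => /(_ isT); lia.
have ke : (k <= e)%N.
  by have := emax k.-1; rewrite sE eqxx prednK // hkn => /(_ isT); lia.
have mid (i : nat) : (r <= i)%N -> (i < e)%N -> sv A i.+1 = s.
  move=> ri ie; apply/eqP; rewrite eq_le -{1}rs -{1}es.
  by rewrite !sdec' //; lia.
have smid i : sv A i.+1 = s -> (i < n)%N -> (r <= i < e)%N.
  move=> si i_n; have := rmin i; have := emax i.
  by rewrite si eqxx i_n => /(_ isT) h1 /(_ isT) h2; apply/andP; split; lia.
(* [e - (k - r), e) are the last [k - r] positions of the eigenspace of [s];
   [gam] moves onto them those of [r, k) that are not already there *)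
pose gam i := if (i < r)%N || (e - (k - r) <= i)%N then i
  else (i + maxn (k - r) (e - k))%N.
have gam_lt i : (i < k)%N -> (gam i < n)%N by rewrite /gam; case: ifP; lia.
pose f (i : 'I_k) := widen_ord hkn i.
pose g (i : 'I_k) := Ordinal (gam_lt i (ltn_ord i)).
have finj : injective f by move=> i j /(congr1 val) /= /val_inj.
have ginj : injective g.
  move=> [i ik] [j jk] /(congr1 val) /=; rewrite /gam => h; apply: val_inj => /=.
  by move: h; case: ifP; case: ifP; lia.
(* A moved index lands at [k] or beyond, outside the image of [f]; hence different pairs f i, g i
   are disjoint. *)
have gf i j : g i = f j -> g i = f i.
  move=> /(congr1 val) /=; rewrite /gam => h; apply: val_inj; move: h => /=.
  have := ltn_ord i; have := ltn_ord j.
  by rewrite /gam; case: ifP => //; lia.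
have gfs i : g i != f i -> sv A (f i).+1 = s /\ sv A (g i).+1 = s.
  move=> gi; have : gam i != i by [].
  rewrite /= /gam; case: ifP => [|h _]; first by rewrite eqxx.
  by have ik := ltn_ord i; split; apply: mid; lia.
pose S2 := g @: [set: 'I_k].
have S2P (j : 'I_n) : (j \in S2) = (j < r)%N || ((e - (k - r) <= j) && (j < e))%N.
  apply/imsetP/idP => [[i _ ->] /=|h].
    by have := ltn_ord i; rewrite /gam; case: ifP; lia.
  have [jk|kj] := ltnP j k.
    exists (Ordinal jk) => //; apply: val_inj; rewrite /= /gam; case: ifP; lia.
  have ik : (j - maxn (k - r) (e - k) < k)%N by lia.
  by exists (Ordinal ik) => //; apply: val_inj; rewrite /= /gam; case: ifP; lia.
have cardS2 : #|S2| = k by rewrite card_imset // cardsT card_ord.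
have k01 : (0 < k <= n)%N by rewrite hk1 hkn.
have hMt : M^H = M by rewrite /M -hermpart_conj hermpart_adj.
have Mr j : M j j \is Num.real by apply/CrealP; rewrite -adjmxE hMt.
have V0 : 0 <= \sum_i M (f i) (f i).
  rewrite -(sum_first_set hkn (fun i => M i i)).
  have lastk : (k.-1 < n)%N by rewrite prednK.
  (* The diagonal of [M] decreases inside the eigenspace, so its entry at position [k - 1] is a
     threshold for the first [k] indices. *)
  apply: (minimal_top_sum_ge0 (mu := M (Ordinal lastk) (Ordinal lastk))
    k01 hU hpolar hE hD sk M0 (card_first_set hkn) _ _ (Mr _) _ _ hmin) => j;
    rewrite inE => jk.
  - by rewrite -/s -sE sdec' //; lia.
  - by rewrite -/s -sE sdec' //; lia.
  - by move=> sj; apply: Mdec; rewrite ?sj /= ?sE //; lia.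
  - by move=> sj; apply: Mdec; rewrite ?sj /= ?sE //; lia.
(* Passing to [- B] negates [M] and keeps minimality, as [t] takes both signs. The bottom positions
   become the top ones, with threshold at the first of them, [e - (k - r)]. *)
have W0 : \sum_i M (g i) (g i) <= 0.
  have pn : (e - (k - r) < n)%N by lia.
  have MN i j : (E^H *m hermpart (U^H *m - B) *m E) i j = - M i j.
    by rewrite mulmxN hermpartN mulmxN mulNmx [LHS]mxE.
  rewrite -oppr_ge0 -sumrN.
  have -> : \sum_i - M (g i) (g i) =
      \sum_(j in S2) (E^H *m hermpart (U^H *m - B) *m E) j j.
    rewrite big_imset /=; last by move=> i j _ _; apply: ginj.
    by apply: eq_big => [i|i _]; rewrite ?inE // MN.
  apply: (minimal_top_sum_ge0 (mu := - M (Ordinal pn) (Ordinal pn))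
    k01 hU hpolar hE hD sk _ cardS2) => [i j ij sij|j|j||j|j|t tr].
  - by rewrite MN M0 // oppr0.
  - by rewrite S2P => h; rewrite -/s -es sdec' //; lia.
  - by rewrite S2P => h; rewrite -/s -rs sdec' //; lia.
  - by rewrite rpredN.
  - rewrite S2P => h sj; have := smid j sj (ltn_ord j) => h'.
    rewrite MN lerN2; apply: Mdec; rewrite ?sj /= ?mid //; lia.
  - rewrite S2P => h sj; have := smid j sj (ltn_ord j) => h'.
    rewrite MN lerN2; apply: Mdec; rewrite ?sj /= ?mid //; lia.
  - by rewrite scalerN -scaleNr; apply: hmin; rewrite rpredN.
have [l /andP[l0 l1] lVW] := convex_zero W0 V0.
(* If [g i = f i] the two basis vectors coincide, and a rotation would spoil the norm; such a vector
   is left unchanged. *)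
pose c i := if g i == f i then 1 else sqrtC l.
pose d i := if g i == f i then 0 else sqrtC (1 - l).
have cr i : (c i)^* = c i.
  by rewrite conj_Creal // /c; case: ifP => _; rewrite ?rpred1 // ger0_real // sqrtC_ge0.
have dr i : (d i)^* = d i.
  rewrite conj_Creal // /d; case: ifP => _; rewrite ?rpred0 // ger0_real //.
  by rewrite sqrtC_ge0 subr_ge0.
have cd1 i : c i * c i + d i * d i = 1.
  rewrite /c /d; case: ifP => _; first by rewrite mulr1 mulr0 addr0.
  by rewrite -!expr2 !sqrtCK addrC subrK.
have d0 i : g i = f i -> d i = 0 by rewrite /d => ->; rewrite eqxx.
pose w i : 'cV[C]_n := c i *: delta_mx (f i) 0 + d i *: delta_mx (g i) 0.
exists (fun i => E *m w i); split.
- move=> i j; rewrite inner_adj mulmxA unitary_mulVmx // mul1mx.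
  have dd a b : inner (delta_mx a 0) (delta_mx b 0) = (a == b)%:R :> C.
    by rewrite -[delta_mx b 0]mul1mx inner_delta mxE.
  rewrite /w !(innerDl, innerDr, innerZl, innerZr) !dd cr dr.
  rewrite (inj_eq finj) (inj_eq ginj) !mulrDr.
  have -> : d i * (c j * (g i == f j)%:R) = 0.
    by case: eqP => [/gf/d0->|_]; rewrite ?mul0r ?mulr0.
  have -> : c i * (d j * (f i == g j)%:R) = 0.
    by case: eqP => [/esym/gf/d0->|_]; rewrite ?mul0r ?mulr0.
  by case: eqP => [->|_]; rewrite ?mulr0 ?addr0 // add0r !mulr1 cd1.
- move=> i; rewrite {1}hD !mulmxA -[_ *m E^H *m E]mulmxA unitary_mulVmx // mulmx1.
  rewrite -mulmxA scalemxAr; congr (_ *m _).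
  have Dd a : diag_mx (\row_(i < n) sv A i.+1) *m delta_mx a 0 =
      sv A a.+1 *: delta_mx a 0 :> 'cV[C]_n.
    apply/colP=> b; rewrite mul_diag_mx !mxE.
    by have [->|ba] := eqVneq b a; rewrite ?mulr0.
  rewrite /w mulmxDr -!scalemxAr !Dd scalerDr !scalerA; congr (_ + _ *: _).
    by rewrite mulrC.
  have [/d0->|/gfs[<- ->]] := eqVneq (g i) (f i); first by rewrite mul0r mulr0.
  by rewrite mulrC.
(* Index by index: an unmoved one contributes the same entry to both sums, a moved one the
   combination with weights l and 1 - l. *)
rewrite -[RHS]lVW !mulr_sumr -big_split; apply: eq_bigr => i _ /=.
rewrite Re_inner_hermpart.
have -> : inner (E *m w i) (hermpart (U^H *m B) *m (E *m w i)) =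
    inner (w i) (M *m w i).
  by rewrite /M -!mulmxA [RHS]inner_adj adjmxK.
rewrite /w mulmxDr -!scalemxAr !(innerDl, innerDr, innerZl, innerZr) !inner_delta.
rewrite cr dr /c /d; case: eqVneq => [->|gi]; first by ring.
have [sf sg] := gfs i gi.
(* The cross entries vanish because [f i] and [g i] lie in the same eigenspace. *)
rewrite (M0 _ _ gi) ?sf ?sg // (M0 (f i) (g i)) ?sf ?sg // 1?eq_sym //.
rewrite !mulr0 addr0 add0r !mulrA -!expr2 !sqrtCK //.
Qed.
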